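(* Let $f:I\to\mathbb{R}$, with $I\subset\mathbb{R}$ an open interval, have a sufficient number of continuous derivatives in a neighborhood of $\alpha\in I$, where $\alpha$ is a simple root of $f$. Consider the two-step iterative method $$y_n=x_n-a\,\frac{f(x_n)}{f'(x_n)},\qquad x_{n+1}=x_n-\{P(t)\times Q(t)\}\,\frac{f(x_n)}{f'(x_n)},\qquad t=\frac{f'(y_n)}{f'(x_n)},$$ where $P$ and $Q$ are real-valued weight functions and $a$ is a real constant. Then this method has fourth-order convergence when $a=\tfrac23$ and the weight functions $P$ and $Q$ satisfy $$P(1)=1,\qquad P'(1)=-\tfrac12,\qquad |P^{(3)}(1)|<+\infty,$$ $$Q(1)=1,\qquad Q'(1)=-\tfrac14,\qquad Q''(1)=2-P''(1),\qquad |Q^{(3)}(1)|<+\infty .$$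
   Context: A root $\alpha$ of $f$ is simple if $f(\alpha)=0$ and $f'(\alpha)\neq 0$. Order of convergence: let $f$ be a real-valued function with a simple root $\alpha$ and let $(x_n)$ be a sequence of real numbers that converges to $\alpha$. The order of convergence $m\in\mathbb{R}^+$ is given by $$\lim_{n\to\infty}\frac{x_{n+1}-\alpha}{(x_n-\alpha)^m}=\zeta\neq 0,$$ where $\zeta$ is the asymptotic error constant. Fourth-order convergence of the method means that this holds with $m=4$ for the sequence $(x_n)$ generated by the method and converging to $\alpha$.
   Formalization: Fourth order is asserted only when the explicit e^4 coefficient (asymptotic error constant) is nonzero and no iterate equals α; otherwise it fails, e.g. for f(x)=x+x³ at α=0, where the limit with m=4 is 0. The limit itself is always shown to equal that coefficient. *)

(* Defs.v *)
From Stdlib Require Import Reals Factorial.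
From Coquelicot Require Import Coquelicot.
Open Scope R_scope.

Definition in_open_interval (lo hi : Rbar) (x : R) : Prop :=
  Rbar_lt lo x /\ Rbar_lt x hi.

Definition simple_root (f : R -> R) (alpha : R) : Prop :=
  f alpha = 0 /\ ex_derive f alpha /\ Derive f alpha <> 0.

Definition C_near (n : nat) (f : R -> R) (alpha : R) : Prop :=
  locally alpha (fun x => forall k, (k <= n)%nat ->
    ex_derive_n f k x /\ continuous (Derive_n f k) x).

(* [Derive_n] is total, so [ex_derive_n f n x] alone does not say that the
   lower-order derivatives exist around [x]; this is required separately. *)
Definition n_times_derivable_at (n : nat) (f : R -> R) (x : R) : Prop :=
  (forall k, (k < n)%nat -> locally x (ex_derive_n f k)) /\ ex_derive_n f n x.

(* Only integer orders are covered: the errors [x n - alpha] may be negative.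
   As [zeta <> 0] and [0 / 0 = 0] in Rocq, a sequence that reaches [alpha] and
   stays there has no order of convergence. *)
Definition order_of_convergence (x : nat -> R) (alpha : R) (m : nat) : Prop :=
  (0 < m)%nat /\
  exists zeta : R, zeta <> 0 /\
    is_lim_seq (fun n => (x (S n) - alpha) / (x n - alpha) ^ m) zeta.

Definition y_step (a : R) (f : R -> R) (x : R) : R :=
  x - a * (f x / Derive f x).

Definition t_ratio (a : R) (f : R -> R) (x : R) : R :=
  Derive f (y_step a f x) / Derive f x.

Definition x_step (a : R) (P Q f : R -> R) (x : R) : R :=
  x - (P (t_ratio a f x) * Q (t_ratio a f x)) * (f x / Derive f x).

(* The first two clauses say that every quantity in the iteration is defined;
   [f] is only meaningful on the interval [I]. *)
Definition generated_by_method
    (I : R -> Prop) (a : R) (P Q f : R -> R) (x : nat -> R) : Prop :=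
  forall n,
    (I (x n) /\ ex_derive f (x n) /\ Derive f (x n) <> 0) /\
    (I (y_step a f (x n)) /\ ex_derive f (y_step a f (x n))) /\
    x (S n) = x_step a P Q f (x n).

Definition taylor_ratio (f : R -> R) (alpha : R) (k : nat) : R :=
  Derive_n f k alpha / (INR (fact k) * Derive f alpha).

(* The coefficient of [e^4] in the expansion of
   [x_step (2/3) P Q f (alpha + e) - alpha].  With [H = P * Q] and
   [c k = taylor_ratio f alpha k], it is
   [(5 + 32/81 * H'''(1)) * c 2 ^ 3 - c 2 * c 3 + c 4 / 9], where the conditions
   on [P] and [Q] at 1 give [H'''(1) = P'''(1) + Q'''(1) + 3/4 * P''(1) - 3].
   It vanishes for some [f], for instance for affine [f]. *)
Definition error_constant (P Q f : R -> R) (alpha : R) : R :=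
  let c := taylor_ratio f alpha in
  let H3 := Derive_n P 3 1 + Derive_n Q 3 1 + 3 / 4 * Derive_n P 2 1 - 3 in
  (5 + 32 / 81 * H3) * c 2%nat ^ 3 - c 2%nat * c 3%nat + c 4%nat / 9.

(* Main.v *)
(* Put [e n = x n - alpha].  With [u = f (x n) / (f' (x n) * e n)] the error
   satisfies [(x (n+1) - alpha) / e = 1 - P t * Q t * u], and every factor has an
   expansion in powers of [e] up to [o(e^3)], obtained from Taylor's formula with
   Peano remainder ([f (x n) / e] uses the fourth derivative of [f]).  The
   conditions on [P], [Q] and [a] are those cancelling the coefficients of [1],
   [e] and [e^2]; the coefficient of [e^3] is the error constant. *)

Require Import Defs.
From Stdlib Require Import Reals Factorial Lra Lia.
From Coquelicot Require Import Coquelicot.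
Open Scope R_scope.

(** * Taylor's formula with Peano remainder *)

Lemma Derive_n_Derive (g : R -> R) (n : nat) (x : R) :
  Derive_n (Derive g) n x = Derive_n g (S n) x.
Proof.
  change (Derive g) with (Derive_n g 1).
  now rewrite Derive_n_comp, Nat.add_1_r.
Qed.

Lemma ex_derive_n_Derive (g : R -> R) (n : nat) (x : R) :
  ex_derive_n g (S n) x -> ex_derive_n (Derive g) n x.
Proof.
  destruct n as [|n]; [easy|]; simpl.
  apply ex_derive_ext; intros t; symmetry; exact (Derive_n_Derive g n t).
Qed.

Lemma n_times_derivable_at_Derive (n : nat) (g : R -> R) (x : R) :
  n_times_derivable_at (S n) g x -> n_times_derivable_at n (Derive g) x.
Proof.
  intros [Hlow Htop]; split.
  - intros k Hk; assert (HSk : (S k < S n)%nat) by lia.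
    refine (filter_imp _ _ _ (Hlow _ HSk)); intros y; apply ex_derive_n_Derive.
  - now apply ex_derive_n_Derive.
Qed.

Lemma C_near_n_times_derivable_at (n : nat) (g : R -> R) (x : R) :
  C_near n g x -> n_times_derivable_at n g x.
Proof.
  intros H; split.
  - intros k Hk; refine (filter_imp _ _ _ H); intros y Hy; apply Hy; lia.
  - apply (locally_singleton _ _ H); lia.
Qed.

Definition taylor_poly (g : R -> R) (n : nat) (c y : R) : R :=
  sum_f_R0 (fun k => Derive_n g k c / INR (fact k) * (y - c) ^ k) n.

Lemma taylor_poly_center (g : R -> R) (n : nat) (c : R) :
  taylor_poly g n c c = g c.
Proof.
  unfold taylor_poly; induction n as [|n IH]; simpl sum_f_R0.
  - simpl; field.
  - rewrite IH; replace (c - c) with 0 by ring; simpl pow; ring.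
Qed.

(** Each exponent cancels one factor of the factorial below it. This lets an estimate for [Derive g]
    be integrated to one for [g]. *)
Lemma is_derive_taylor_poly (g : R -> R) (n : nat) (c y : R) :
  is_derive (taylor_poly g (S n) c) y (taylor_poly (Derive g) n c y).
Proof.
  unfold taylor_poly; induction n as [|n IH].
  - simpl; auto_derive; [trivial|].
    change (Derive (fun x => g x) c) with (Derive g c); field.
  - refine (is_derive_plus (V := R_NormedModule) _ _ _ _ _ IH _).
    rewrite Derive_n_Derive.
    assert (Hn := INR_fact_neq_0 (S n)); assert (HS := not_0_INR (S (S n)) ltac:(lia)).
    rewrite (fact_simpl (S n)), mult_INR.
    set (p := INR (fact (S n))) in *; set (q := INR (S (S n))) in *.
    set (D := Derive_n g (S (S n)) c).
    auto_derive; [trivial|].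
    change (D / (q * p) * (1 * (q * (y - c) ^ S n)) = D / p * (y - c) ^ S n).
    field; auto.
Qed.

(* Induction on the order: integrating the estimate for [Derive g] with the
   mean value theorem needs no continuity of the top derivative. *)
Lemma taylor_peano (n : nat) (g : R -> R) (c : R) :
  n_times_derivable_at (S n) g c ->
  forall eps : posreal, locally c (fun y =>
    Rabs (g y - taylor_poly g (S n) c y) <= eps * Rabs (y - c) ^ S n).
Proof.
  revert g; induction n as [|n IH]; intros g Hg eps.
  (* At order one the estimate is the definition of the derivative at [c]. *)
  - destruct Hg as [_ Hg]; apply Derive_correct in Hg.
    destruct Hg as [_ Hg].
    refine (filter_imp _ _ _ (Hg c (fun P HP => HP) eps)); intros y Hy.
    replace (g y - taylor_poly g 1 c y)
      with (minus (minus (g y) (g c)) (scal (minus y c) (Derive g c))).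
    + rewrite pow_1; exact Hy.
    + unfold taylor_poly, minus, plus, opp, scal; simpl; unfold mult; simpl.
      change (Derive (fun x => g x) c) with (Derive g c); field.
  - destruct (IH _ (n_times_derivable_at_Derive _ _ _ Hg) eps) as [d1 H1].
    destruct (proj1 Hg 1%nat ltac:(lia)) as [d2 H2].
    (* The mean value theorem is applied on a closed interval; halving the radius keeps it inside
       both open neighbourhoods. *)
    assert (Hd : 0 < Rmin d1 d2 / 2)
      by (apply Rdiv_lt_0_compat; [apply Rmin_glb_lt; apply cond_pos|lra]).
    exists (mkposreal _ Hd); intros y Hy.
    assert (Hm1 := Rmin_l d1 d2); assert (Hm2 := Rmin_r d1 d2).
    destruct (MVT_cor4 (fun y => g y - taylor_poly g (S (S n)) c y)
      (fun y => Derive g y - taylor_poly (Derive g) (S n) c y)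
      c (Rmin d1 d2 / 2)) with (b := y) as [z [Hz Hzc]].
    + intros z Hz; refine (is_derive_minus (V := R_NormedModule) _ _ _ _ _ _ _).
      * apply Derive_correct, (H2 z). change (Rabs (z - c) < d2); lra.
      * apply is_derive_taylor_poly.
    + apply Rlt_le, Hy.
    + rewrite taylor_poly_center, Rminus_diag, Rminus_0_r in Hz by trivial.
      rewrite Hz, Rabs_mult.
      assert (Hyd : Rabs (y - c) < Rmin d1 d2 / 2) by exact Hy.
      assert (Hzd : Rabs (z - c) < d1) by lra.
      specialize (H1 z Hzd).
      replace (eps * Rabs (y - c) ^ S (S n))
        with (eps * Rabs (y - c) ^ S n * Rabs (y - c)) by (simpl; ring).
      apply Rmult_le_compat_r; [apply Rabs_pos|].
      eapply Rle_trans; [exact H1|].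
      apply Rmult_le_compat_l; [apply Rlt_le, cond_pos|].
      apply pow_incr; split; [apply Rabs_pos|exact Hzc].
Qed.

(** Writing the remainder as a convergent coefficient times a power reduces later expansions to
    algebra of limits. The coefficient is set to its limit wherever [x k = c], so the sequence may
    hit [c], as the ratio [t] may hit 1. *)
Lemma taylor_seq (n : nat) (g : R -> R) (c : R) (x : nat -> R) :
  n_times_derivable_at (S n) g c -> is_lim_seq x c ->
  exists d : nat -> R,
    is_lim_seq d (Derive_n g (S n) c / INR (fact (S n))) /\
    forall k, g (x k) = taylor_poly g n c (x k) + d k * (x k - c) ^ S n.
Proof.
  intros Hg Hx.
  set (G := Derive_n g (S n) c / INR (fact (S n))).
  exists (fun k => if Req_EM_T (x k) c then G
                   else (g (x k) - taylor_poly g n c (x k)) / (x k - c) ^ S n).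
  split.
  - apply is_lim_seq_spec; intros eps.
    assert (H := Hx _ (taylor_peano n g c Hg (pos_div_2 eps))).
    destruct H as [N HN]; exists N; intros k Hle; assert (Hk := HN k Hle); clear HN.
    destruct (Req_EM_T (x k) c) as [e|e].
    + rewrite Rminus_diag, Rabs_R0 by trivial; apply cond_pos.
    + assert (Hp : (x k - c) ^ S n <> 0) by (apply pow_nonzero; lra).
      assert (Ha : 0 < Rabs (x k - c) ^ S n)
        by (apply pow_lt, Rabs_pos_lt; lra).
      apply Rle_lt_trans with (eps / 2); [|generalize (cond_pos eps); lra].
      apply Rmult_le_reg_r with (1 := Ha).
      rewrite RPow_abs at 1; rewrite <- Rabs_mult.
      eapply Rle_trans; [|exact Hk]; apply Req_le; f_equal.
      change (taylor_poly g (S n) c (x k))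
        with (taylor_poly g n c (x k) + G * (x k - c) ^ S n).
      field; exact Hp.
  - intros k; destruct (Req_EM_T (x k) c) as [e|e].
    + rewrite e, taylor_poly_center, Rminus_diag by trivial; simpl; ring.
    + assert (Hp : (x k - c) ^ S n <> 0) by (apply pow_nonzero; lra); field; exact Hp.
Qed.

(** * Arithmetic of third-order expansions along a sequence *)

Lemma is_lim_seq_eq (u : nat -> R) (l l' : R) :
  is_lim_seq u l -> l = l' -> is_lim_seq u l'.
Proof. now intros H <-. Qed.

(** Computes the limit of a polynomial in convergent sequences and leaves its equality with the
    claimed limit as the goal. *)
Ltac lim_seq_poly :=
  eapply is_lim_seq_eq;
  [ repeat first [ eassumption | apply is_lim_seq_const
                 | apply is_lim_seq_minus' | apply is_lim_seq_mult'
                 | apply is_lim_seq_plus' ] |].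

(* [u = a0 + a1 e + a2 e^2 + a3 e^3 + o(e^3)] along the sequence [e]. *)
Definition expands3 (e u : nat -> R) (a0 a1 a2 a3 : R) : Prop :=
  exists d : nat -> R, is_lim_seq d a3 /\
    forall n, u n = a0 + a1 * e n + a2 * e n ^ 2 + d n * e n ^ 3.

Lemma expands3_ext (e u v : nat -> R) (a0 a1 a2 a3 b0 b1 b2 b3 : R) :
  expands3 e u a0 a1 a2 a3 -> (forall n, u n = v n) ->
  a0 = b0 -> a1 = b1 -> a2 = b2 -> a3 = b3 -> expands3 e v b0 b1 b2 b3.
Proof.
  intros [d [Hd Hu]] Huv <- <- <- <-; exists d; split; [exact Hd|].
  intros n; rewrite <- Huv; apply Hu.
Qed.

Lemma expands3_const (e : nat -> R) (c : R) : expands3 e (fun _ => c) c 0 0 0.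
Proof.
  exists (fun _ => 0); split; [apply is_lim_seq_const|intros; ring].
Qed.

Lemma expands3_id (e : nat -> R) : expands3 e e 0 1 0 0.
Proof.
  exists (fun _ => 0); split; [apply is_lim_seq_const|intros; ring].
Qed.

Lemma expands3_minus (e u v : nat -> R) (a0 a1 a2 a3 b0 b1 b2 b3 : R) :
  expands3 e u a0 a1 a2 a3 -> expands3 e v b0 b1 b2 b3 ->
  expands3 e (fun n => u n - v n) (a0 - b0) (a1 - b1) (a2 - b2) (a3 - b3).
Proof.
  intros [da [Hda Hu]] [db [Hdb Hv]]; exists (fun n => da n - db n); split.
  - now apply is_lim_seq_minus'.
  - intros n; rewrite Hu, Hv; ring.
Qed.

Lemma expands3_mult (e u v : nat -> R) (a0 a1 a2 a3 b0 b1 b2 b3 : R) :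
  is_lim_seq e 0 ->
  expands3 e u a0 a1 a2 a3 -> expands3 e v b0 b1 b2 b3 ->
  expands3 e (fun n => u n * v n) (a0 * b0) (a0 * b1 + a1 * b0)
    (a0 * b2 + a1 * b1 + a2 * b0) (a0 * b3 + a1 * b2 + a2 * b1 + a3 * b0).
Proof.
  intros He [da [Hda Hu]] [db [Hdb Hv]].
  (* All terms of the product of order at least three, divided by [e n ^ 3]; those above order three
     vanish in the limit. *)
  exists (fun n => a0 * db n + a1 * b2 + a2 * b1 + da n * b0
    + e n * (a1 * db n + a2 * b2 + da n * b1
    + e n * (a2 * db n + da n * b2 + e n * (da n * db n)))); split.
  - lim_seq_poly; ring.
  - intros n; rewrite Hu, Hv; ring.
Qed.

Lemma expands3_lim (e u : nat -> R) (a0 a1 a2 a3 : R) :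
  is_lim_seq e 0 -> expands3 e u a0 a1 a2 a3 -> is_lim_seq u a0.
Proof.
  intros He [d [Hd Hu]].
  apply is_lim_seq_ext
    with (fun n => a0 + e n * (a1 + e n * (a2 + e n * d n))).
  - intros n; rewrite Hu; ring.
  - lim_seq_poly; ring.
Qed.

Lemma expands3_inv (e u : nat -> R) (a0 a1 a2 a3 : R) :
  is_lim_seq e 0 -> a0 <> 0 -> (forall n, u n <> 0) ->
  expands3 e u a0 a1 a2 a3 ->
  expands3 e (fun n => / u n) (/ a0) (- a1 / a0 ^ 2)
    (a1 ^ 2 / a0 ^ 3 - a2 / a0 ^ 2)
    (- a3 / a0 ^ 2 + 2 * a1 * a2 / a0 ^ 3 - a1 ^ 3 / a0 ^ 4).
Proof.
  intros He Ha0 Hu0 Hexp.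
  assert (Hlim := expands3_lim _ _ _ _ _ _ He Hexp).
  assert (Hinv : is_lim_seq (fun n => / u n) (/ a0)).
  { apply (is_lim_seq_inv _ _ Hlim); intros H; apply Ha0; now injection H. }
  destruct Hexp as [d [Hd Hu]].
  set (b1 := - a1 / a0 ^ 2); set (b2 := a1 ^ 2 / a0 ^ 3 - a2 / a0 ^ 2).
  (* With [p = / a0 + b1 * e + b2 * e ^ 2], one has [/ u - p = (1 - u * p) / u], and [b1], [b2] are
     chosen so that [1 - u * p] starts at [e ^ 3]. *)
  exists (fun n => (-1 * / u n)
    * (a1 * b2 + a2 * b1 + d n * / a0 + e n * (a2 * b2 + d n * b1 + e n * (d n * b2)))).
  split.
  - lim_seq_poly; unfold b1, b2; field; exact Ha0.
  - intros n; assert (Hn := Hu0 n); rewrite Hu in *; unfold b1, b2; field; auto.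
Qed.

#[local] Arguments Derive_n : simpl never.

Lemma expands3_comp (e s : nat -> R) (g : R -> R) (c b1 b2 b3 : R) :
  is_lim_seq e 0 -> n_times_derivable_at 3 g c -> expands3 e s c b1 b2 b3 ->
  expands3 e (fun n => g (s n)) (g c) (Derive g c * b1)
    (Derive g c * b2 + Derive_n g 2 c / 2 * b1 ^ 2)
    (Derive g c * b3 + Derive_n g 2 c * b1 * b2 + Derive_n g 3 c / 6 * b1 ^ 3).
Proof.
  intros He Hg Hs.
  destruct (taylor_seq 2 g c s Hg (expands3_lim _ _ _ _ _ _ He Hs)) as [G [HG Hgs]].
  destruct Hs as [d [Hd Hs]].
  (* Here [s n - c = e n * w n], with [w] tending to [b1] and [v] to [b2]. In the quadratic Taylor
     term, [w ^ 2 - b1 ^ 2 = e * (2 * b1 * v + e * v ^ 2)] moves to the cubic coefficient. *)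
  set (v := fun n => b2 + e n * d n); set (w := fun n => b1 + e n * v n).
  exists (fun n => Derive g c * d n
    + Derive_n g 2 c / 2 * (2 * b1 * v n + e n * v n * v n) + G n * (w n * w n * w n)).
  split.
  - unfold w, v; lim_seq_poly; simpl; field.
  - intros n; rewrite Hgs.
    replace (s n) with (c + e n * w n) by (rewrite Hs; unfold w, v; ring).
    change (Derive g c) with (Derive_n g 1 c).
    unfold taylor_poly, w, v; simpl; change (Derive_n g 0 c) with (g c); field.
Qed.

(** Dividing by [x n - c] costs one order, hence the fourth derivative. *)
Lemma expands3_slope (x : nat -> R) (g : R -> R) (c : R) :
  n_times_derivable_at 4 g c -> is_lim_seq x c -> (forall n, x n <> c) ->
  expands3 (fun n => x n - c) (fun n => (g (x n) - g c) / (x n - c))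
    (Derive g c) (Derive_n g 2 c / 2) (Derive_n g 3 c / 6) (Derive_n g 4 c / 24).
Proof.
  intros Hg Hx Hne.
  destruct (taylor_seq 3 g c x Hg Hx) as [d [Hd Hgx]].
  exists d; split.
  - eapply is_lim_seq_eq; [exact Hd|simpl; field].
  - intros n; rewrite Hgx; change (Derive g c) with (Derive_n g 1 c).
    unfold taylor_poly; simpl; change (Derive_n g 0 c) with (g c); field.
    specialize (Hne n); lra.
Qed.

(** * Expansion of the error of the method *)

Theorem theorem2p2
  (lo hi : Rbar) (f : R -> R) (alpha : R)
  (Halpha : in_open_interval lo hi alpha)
  (Hsmooth : C_near 4 f alpha)
  (Hroot : simple_root f alpha)
  (a : R) (P Q : R -> R)
  (Ha : a = 2 / 3)
  (HP : n_times_derivable_at 3 P 1)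
  (HP0 : P 1 = 1)
  (HP1 : Derive P 1 = - (1 / 2))
  (HQ : n_times_derivable_at 3 Q 1)
  (HQ0 : Q 1 = 1)
  (HQ1 : Derive Q 1 = - (1 / 4))
  (HQ2 : Derive_n Q 2 1 = 2 - Derive_n P 2 1)
  (x : nat -> R)
  (Hx : generated_by_method (in_open_interval lo hi) a P Q f x)
  (Hlim : is_lim_seq x alpha)
  (Hne : forall n, x n <> alpha) :
  is_lim_seq (fun n => (x (S n) - alpha) / (x n - alpha) ^ 4)
             (error_constant P Q f alpha) /\
  (error_constant P Q f alpha <> 0 -> order_of_convergence x alpha 4).
Proof.
  enough (H : is_lim_seq (fun n => (x (S n) - alpha) / (x n - alpha) ^ 4)
             (error_constant P Q f alpha)).
  { split; [exact H|]; intros Hz; split; [repeat constructor|].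
    now exists (error_constant P Q f alpha). }
  destruct Hroot as [Hf0 [_ Hf1]].
  apply C_near_n_times_derivable_at in Hsmooth.
  assert (Hdf := n_times_derivable_at_Derive _ _ _ Hsmooth).
  set (e := fun n => x n - alpha).
  assert (He : is_lim_seq e 0).
  { unfold e; lim_seq_poly; ring. }
  assert (Hen : forall n, e n <> 0) by (intros n; specialize (Hne n); unfold e; lra).
  assert (Hxe : expands3 e x alpha 1 0 0).
  { exists (fun _ => 0); split; [apply is_lim_seq_const|intros; unfold e; ring]. }
  assert (HF2 : Derive (Derive f) alpha = Derive_n f 2 alpha)
    by exact (Derive_n_Derive f 1 alpha).
  assert (Eslope := expands3_slope x f alpha Hsmooth Hlim Hne); fold e in Eslope.
  set (F1 := Derive f alpha) in *; set (F2 := Derive_n f 2 alpha) in *;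
  set (F3 := Derive_n f 3 alpha) in *; set (F4 := Derive_n f 4 alpha) in *.
  (* Stated for any [s] tending to [alpha], since [Derive f] is expanded along both [x] and the
     intermediate points [y]. *)
  assert (Edf : forall s b1 b2 b3, expands3 e s alpha b1 b2 b3 ->
    expands3 e (fun n => Derive f (s n)) F1 (F2 * b1) (F2 * b2 + F3 / 2 * b1 ^ 2)
      (F2 * b3 + F3 * b1 * b2 + F4 / 6 * b1 ^ 3)).
  { intros s b1 b2 b3 Hs.
    generalize (expands3_comp _ _ _ _ _ _ _ He Hdf Hs).
    now rewrite !Derive_n_Derive, HF2. }
  assert (Einv := expands3_inv _ _ _ _ _ _ He Hf1
    (fun n => proj2 (proj2 (proj1 (Hx n)))) (Edf _ _ _ _ Hxe)).
  (* This is [u = f x / (e * f' x)], so the Newton correction is [e * u]. *)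
  assert (Eu := expands3_mult _ _ _ _ _ _ _ _ _ _ _ He
    Eslope Einv).
  (* The linear coefficient is [1 - a], because [u] tends to 1. *)
  assert (Ey : expands3 e (fun n => y_step a f (x n)) alpha (1 / 3)
    (F2 / (3 * F1)) (2 / 3 * F3 / F1 / 3 - F2 ^ 2 / F1 ^ 2 / 3)).
  { eapply expands3_ext.
    - exact (expands3_minus _ _ _ _ _ _ _ _ _ _ _ Hxe
        (expands3_mult _ _ _ _ _ _ _ _ _ _ _ He (expands3_const e a)
          (expands3_mult _ _ _ _ _ _ _ _ _ _ _ He (expands3_id e) Eu))).
    - intros n; unfold y_step; rewrite Hf0; fold (e n); field.
      split; [apply Hx|apply Hen].
    - ring.
    - rewrite Ha; field; exact Hf1.
    - rewrite Ha; field; exact Hf1.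
    - rewrite Ha; field; exact Hf1. }
  assert (Et : expands3 e (fun n => t_ratio a f (x n)) 1 (- (2 / 3) * (F2 / F1))
    (F2 ^ 2 / F1 ^ 2 - 4 / 9 * (F3 / F1))
    (- (13 / 81) * (F4 / F1) + 10 / 9 * (F2 * F3 / F1 ^ 2) - 4 / 3 * (F2 ^ 3 / F1 ^ 3))).
  { eapply expands3_ext.
    - exact (expands3_mult _ _ _ _ _ _ _ _ _ _ _ He (Edf _ _ _ _ Ey) Einv).
    - intros n; reflexivity.
    - field; exact Hf1.
    - field; exact Hf1.
    - field; exact Hf1.
    - field; exact Hf1. }
  (* The weights are expanded at 1, the limit of [t]. *)
  assert (EH := expands3_mult _ _ _ _ _ _ _ _ _ _ _ He
    (expands3_comp _ _ _ _ _ _ _ He HP Et) (expands3_comp _ _ _ _ _ _ _ He HQ Et)).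
  assert (Eerr := expands3_minus _ _ _ _ _ _ _ _ _ _ _ (expands3_const e 1)
    (expands3_mult _ _ _ _ _ _ _ _ _ _ _ He EH Eu)).
  apply (expands3_ext _ _ (fun n => (x (S n) - alpha) / e n) _ _ _ _ 0 0 0
    (error_constant P Q f alpha)) in Eerr.
  - destruct Eerr as [d [Hd Herr]]; apply is_lim_seq_ext with (2 := Hd); intros n.
    fold (e n); specialize (Herr n).
    replace ((x (S n) - alpha) / e n ^ 4) with ((x (S n) - alpha) / e n / e n ^ 3)
      by (field; apply Hen).
    rewrite Herr; field; apply Hen.
  - intros n; rewrite (proj2 (proj2 (Hx n))); unfold x_step; rewrite Hf0.
    unfold e in *; field; split; [apply Hx|apply Hen].
  (* For [H = P * Q], the coefficients of orders 0, 1 and 2 vanish because [H(1) = 1],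
     [H'(1) = -3/4] and [H''(1) = 9/4]. *)
  - rewrite HP0, HQ0; field; exact Hf1.
  - rewrite HP0, HP1, HQ0, HQ1; field; exact Hf1.
  - rewrite HP0, HP1, HQ0, HQ1, HQ2; field; exact Hf1.
  - unfold error_constant, taylor_ratio; fold F1 F2 F3 F4.
    rewrite HP0, HP1, HQ0, HQ1, HQ2; simpl; field; exact Hf1.
Qed.
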